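(* Let $\mathcal{C}$ be a $\mathbf{DCPO}$-$\dagger$-category. Then the category $\mathbf{DcpoOp}(\mathcal{C})$ of continuous functionals of $\mathcal{C}$, with the symmetric monoidal structure given by the cartesian product and with the involution $\overline{(-)}$ induced by the dagger of $\mathcal{C}$, is an involutive symmetric monoidal category.
   Context: $\mathbf{DCPO}$ is the category of pointed directed complete partial orders (posets with a least element $\bot$ in which every non-empty directed subset has a supremum) and continuous maps (maps preserving suprema of non-empty directed sets; they need not preserve $\bot$). It is cartesian, with componentwise-ordered products and terminal object $1$. A $\mathbf{DCPO}$-category is a category $\mathcal{C}$ in which each homset $\mathcal{C}(X,Y)$ is a pointed directed complete partial order (order $\sqsubseteq$, least element $\bot_{X,Y}$), and composition is continuous and strict (i.e. $\bot\circ f=\bot$ and $g\circ\bot=\bot$ for all suitable morphisms $f,g$). A dagger category is a category $\mathcal{C}$ with a functor $(-)^\dagger:\mathcal{C}^{\mathrm{op}}\to\mathcal{C}$ that is the identity on objects, so $f:X\to Y$ gives $f^\dagger:Y\to X$, with $\mathrm{id}_X^\dagger=\mathrm{id}_X$, $(g\circ f)^\dagger=f^\dagger\circ g^\dagger$ and $f^{\dagger\dagger}=f$. A $\mathbf{DCPO}$-$\dagger$-category is a $\mathbf{DCPO}$-category that is also a dagger category and whose dagger is locally monotone: $f\sqsubseteq g$ implies $f^\dagger\sqsubseteq g^\dagger$ for all parallel $f,g$. $\mathbf{DcpoOp}(\mathcal{C})$ is the category that has as objects all objects $\Theta,\Lambda$ of $\mathbf{DCPO}$ of the form $\mathcal{C}(X,Y)$,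 $\mathcal{C}^{\mathrm{op}}(X,Y)$ (for all objects $X,Y$ of $\mathcal{C}$, where $\mathcal{C}^{\mathrm{op}}(X,Y)=\mathcal{C}(Y,X)$), $1$ (the terminal object of $\mathbf{DCPO}$), and $\Theta\times\Lambda$ (the cartesian product), and as morphisms all continuous functions between these. In other words, it is the full cartesian subcategory of $\mathbf{DCPO}$ generated by the hom-objects used in the enrichment of $\mathcal{C}$. Induced involution: on objects, $\overline{\mathcal{C}(X,Y)}=\mathcal{C}^{\mathrm{op}}(X,Y)$, $\overline{\mathcal{C}^{\mathrm{op}}(X,Y)}=\mathcal{C}(X,Y)$, $\overline{1}=1$, $\overline{\Theta\times\Lambda}=\overline{\Theta}\times\overline{\Lambda}$. Define a family of isomorphisms $\xi_\Theta:\Theta\to\overline{\Theta}$ by $\xi_1=\mathrm{id}_1$, $\xi_{\mathcal{C}(X,Y)}=(-)^\dagger$, $\xi_{\mathcal{C}^{\mathrm{op}}(X,Y)}=(-)^\dagger$, $\xi_{\Theta\times\Lambda}=\xi_\Theta\times\xi_\Lambda$. For a morphism $\varphi:\Theta\to\Lambda$ put $\overline{\varphi}=\xi_\Lambda\circ\varphi\circ\xi_\Theta^{-1}:\overline{\Theta}\to\overline{\Lambda}$. The natural isomorphism $\iota:\mathrm{id}\Rightarrow\overline{\overline{(-)}}$ is the identity in each component. A category $\mathcal{V}$ is involutive if it is equipped with a (covariant) functor $\overline{(-)}:\mathcal{V}\to\mathcal{V}$ and a natural isomorphism $\iota:\mathrm{id}\Rightarrow\overline{\overline{(-)}}$ satisfying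 $\iota_{\overline{X}}=\overline{\iota_X}$. An involutive symmetric monoidal category is a symmetric monoidal category that is also involutive, such that the involution is a monoidal functor and $\iota$ is a monoidal natural isomorphism. *)

(* Defs.v *)
From Stdlib Require Import Relation_Definitions FunctionalExtensionality ProofIrrelevance.

Set Implicit Arguments.
Unset Strict Implicit.
Unset Printing Implicit Defensive.

Record category := Category {
  ob :> Type;
  hom : ob -> ob -> Type;
  idm : forall X, hom X X;
  comp : forall X Y Z, hom Y Z -> hom X Y -> hom X Z;
  comp_id_l : forall X Y (f : hom X Y), comp (idm Y) f = f;
  comp_id_r : forall X Y (f : hom X Y), comp f (idm X) = f;
  comp_assoc : forall W X Y Z (h : hom Y Z) (g : hom X Y) (f : hom W X),
    comp h (comp g f) = comp (comp h g) f
}.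
Arguments hom {c} X Y.
Arguments idm {c} X.
Arguments comp {c X Y Z} g f.

Declare Scope cat_scope.
Delimit Scope cat_scope with cat.
Open Scope cat_scope.
Notation "g \o f" := (comp g f) (at level 40, left associativity) : cat_scope.

Record iso (C : category) (X Y : C) := Iso {
  iso_hom : hom X Y;
  iso_inv : hom Y X;
  iso_hom_inv : iso_inv \o iso_hom = idm X;
  iso_inv_hom : iso_hom \o iso_inv = idm Y
}.

Definition is_iso (C : category) (X Y : C) (f : hom X Y) : Prop :=
  exists g : hom Y X, g \o f = idm X /\ f \o g = idm Y.

(* The identity, seen as a morphism between two propositionally equal objects. *)
Definition eq_hom (C : category) (X Y : C) (e : X = Y) : hom X Y :=
  match e in _ = Z return hom X Z with eq_refl => idm X end.

Definition full_subcategory (D : category) (T : Type) (F : T -> D) : category :=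
  {| ob := T;
     hom := fun X Y => hom (F X) (F Y);
     idm := fun X => idm (F X);
     comp := fun X Y Z g f => g \o f;
     comp_id_l := fun X Y f => comp_id_l f;
     comp_id_r := fun X Y f => comp_id_r f;
     comp_assoc := fun W X Y Z h g f => comp_assoc h g f |}.

Record functor_data (C D : category) := FunctorData {
  fob :> C -> D;
  fmap : forall X Y, hom X Y -> hom (fob X) (fob Y)
}.
Arguments fmap {C D} F {X Y} f : rename.

Record is_functor (C D : category) (F : functor_data C D) : Prop := IsFunctor {
  fmap_id : forall X, fmap F (idm X) = idm (F X);
  fmap_comp : forall X Y Z (g : hom Y Z) (f : hom X Y),
    fmap F (g \o f) = fmap F g \o fmap F f
}.

Definition id_functor (C : category) : functor_data C C :=
  {| fob := fun X => X; fmap := fun X Y f => f |}.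

Definition comp_functor (C D E : category)
    (G : functor_data D E) (F : functor_data C D) : functor_data C E :=
  {| fob := fun X => G (F X); fmap := fun X Y f => fmap G (fmap F f) |}.

Definition is_natural (C D : category) (F G : functor_data C D)
    (a : forall X, hom (F X) (G X)) : Prop :=
  forall X Y (f : hom X Y), a Y \o fmap F f = fmap G f \o a X.

Definition is_natural_iso (C D : category) (F G : functor_data C D)
    (a : forall X, hom (F X) (G X)) : Prop :=
  is_natural a /\ forall X, is_iso (a X).

Record smc_data (C : category) := SmcData {
  tens : C -> C -> C;
  tmap : forall X X' Y Y', hom X X' -> hom Y Y' -> hom (tens X Y) (tens X' Y');
  tunit : C;
  assoc : forall X Y Z, hom (tens (tens X Y) Z) (tens X (tens Y Z));
  lunit : forall X, hom (tens tunit X) X;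
  runit : forall X, hom (tens X tunit) X;
  swap : forall X Y, hom (tens X Y) (tens Y X)
}.
Arguments tmap {C} M {X X' Y Y'} f g : rename.

Record is_smc (C : category) (M : smc_data C) : Prop := IsSmc {
  tmap_id : forall X Y, tmap M (idm X) (idm Y) = idm (tens M X Y);
  tmap_comp : forall X X' X'' Y Y' Y'' (f' : hom X' X'') (f : hom X X')
      (g' : hom Y' Y'') (g : hom Y Y'),
    tmap M (f' \o f) (g' \o g) = tmap M f' g' \o tmap M f g;
  assoc_iso : forall X Y Z, is_iso (assoc M X Y Z);
  lunit_iso : forall X, is_iso (lunit M X);
  runit_iso : forall X, is_iso (runit M X);
  assoc_natural : forall X X' Y Y' Z Z'
      (f : hom X X') (g : hom Y Y') (h : hom Z Z'),
    assoc M X' Y' Z' \o tmap M (tmap M f g) h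
    = tmap M f (tmap M g h) \o assoc M X Y Z;
  lunit_natural : forall X X' (f : hom X X'),
    lunit M X' \o tmap M (idm (tunit M)) f = f \o lunit M X;
  runit_natural : forall X X' (f : hom X X'),
    runit M X' \o tmap M f (idm (tunit M)) = f \o runit M X;
  swap_natural : forall X X' Y Y' (f : hom X X') (g : hom Y Y'),
    swap M X' Y' \o tmap M f g = tmap M g f \o swap M X Y;
  pentagon : forall W X Y Z,
    assoc M W X (tens M Y Z) \o assoc M (tens M W X) Y Z
    = tmap M (idm W) (assoc M X Y Z) \o assoc M W (tens M X Y) Z
      \o tmap M (assoc M W X Y) (idm Z);
  triangle : forall X Y,
    tmap M (idm X) (lunit M Y) \o assoc M X (tunit M) Y
    = tmap M (runit M X) (idm Y);
  hexagon : forall X Y Z,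
    assoc M Y Z X \o swap M X (tens M Y Z) \o assoc M X Y Z
    = tmap M (idm Y) (swap M X Z) \o assoc M Y X Z
      \o tmap M (swap M X Y) (idm Z);
  swap_swap : forall X Y, swap M Y X \o swap M X Y = idm (tens M X Y)
}.

Record monoidal_functor_data (C D : category) (M : smc_data C) (N : smc_data D) :=
  MonoidalFunctorData {
  mf_functor :> functor_data C D;
  mf_mu : forall X Y,
    hom (tens N (mf_functor X) (mf_functor Y)) (mf_functor (tens M X Y));
  mf_eps : hom (tunit N) (mf_functor (tunit M))
}.

(* Monoidal functors are strong: the comparison maps are invertible. *)
Record is_monoidal_functor (C D : category) (M : smc_data C) (N : smc_data D)
    (F : monoidal_functor_data M N) : Prop := IsMonoidalFunctor {
  mf_is_functor : is_functor F;
  mf_mu_iso : forall X Y, is_iso (mf_mu F X Y);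
  mf_eps_iso : is_iso (mf_eps F);
  mf_mu_natural : forall X X' Y Y' (f : hom X X') (g : hom Y Y'),
    mf_mu F X' Y' \o tmap N (fmap F f) (fmap F g)
    = fmap F (tmap M f g) \o mf_mu F X Y;
  mf_assoc : forall X Y Z,
    fmap F (assoc M X Y Z) \o mf_mu F (tens M X Y) Z
      \o tmap N (mf_mu F X Y) (idm (F Z))
    = mf_mu F X (tens M Y Z) \o tmap N (idm (F X)) (mf_mu F Y Z)
      \o assoc N (F X) (F Y) (F Z);
  mf_lunit : forall X,
    fmap F (lunit M X) \o mf_mu F (tunit M) X \o tmap N (mf_eps F) (idm (F X))
    = lunit N (F X);
  mf_runit : forall X,
    fmap F (runit M X) \o mf_mu F X (tunit M) \o tmap N (idm (F X)) (mf_eps F)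
    = runit N (F X)
}.

Definition id_monoidal_functor (C : category) (M : smc_data C) :
    monoidal_functor_data M M :=
  {| mf_functor := id_functor C;
     mf_mu := fun X Y => idm (tens M X Y);
     mf_eps := idm (tunit M) |}.

Definition comp_monoidal_functor (C D E : category)
    (M : smc_data C) (N : smc_data D) (P : smc_data E)
    (G : monoidal_functor_data N P) (F : monoidal_functor_data M N) :
    monoidal_functor_data M P :=
  {| mf_functor := comp_functor G F;
     mf_mu := fun X Y => fmap G (mf_mu F X Y) \o mf_mu G (F X) (F Y);
     mf_eps := fmap G (mf_eps F) \o mf_eps G |}.

Record is_monoidal_natural_iso (C D : category) (M : smc_data C) (N : smc_data D)
    (F G : monoidal_functor_data M N) (a : forall X, hom (F X) (G X)) : Prop :=
  IsMonoidalNaturalIso {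
  mn_natural_iso : is_natural_iso a;
  mn_mu : forall X Y,
    a (tens M X Y) \o mf_mu F X Y = mf_mu G X Y \o tmap N (a X) (a Y);
  mn_eps : a (tunit M) \o mf_eps F = mf_eps G
}.

Record is_involutive (C : category) (F : functor_data C C)
    (i : forall X, hom X (F (F X))) : Prop := IsInvolutive {
  inv_functor : is_functor F;
  inv_natural_iso : is_natural_iso (F := id_functor C) (G := comp_functor F F) i;
  inv_coherence : forall X, i (F X) = fmap F (i X)
}.

Record is_involutive_smc (C : category) (M : smc_data C)
    (F : monoidal_functor_data M M) (i : forall X, hom X (F (F X))) : Prop :=
  IsInvolutiveSmc {
  ismc_smc : is_smc M;
  ismc_involutive : is_involutive (F := F) i;
  ismc_monoidal_functor : is_monoidal_functor F;
  ismc_monoidal_natural_iso :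
    is_monoidal_natural_iso
      (F := id_monoidal_functor M) (G := comp_monoidal_functor F F) i
}.

Record cartesian (C : category) := Cartesian {
  cprod : C -> C -> C;
  cfst : forall X Y, hom (cprod X Y) X;
  csnd : forall X Y, hom (cprod X Y) Y;
  cpair : forall Z X Y, hom Z X -> hom Z Y -> hom Z (cprod X Y);
  cfst_pair : forall Z X Y (f : hom Z X) (g : hom Z Y), cfst X Y \o cpair f g = f;
  csnd_pair : forall Z X Y (f : hom Z X) (g : hom Z Y), csnd X Y \o cpair f g = g;
  cpair_unique : forall Z X Y (f : hom Z X) (g : hom Z Y) (h : hom Z (cprod X Y)),
    cfst X Y \o h = f -> csnd X Y \o h = g -> h = cpair f g;
  cterm : C;
  cbang : forall Z, hom Z cterm;
  cbang_unique : forall Z (h : hom Z cterm), h = cbang Z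
}.
Arguments cfst {C} K X Y : rename.
Arguments csnd {C} K X Y : rename.
Arguments cpair {C} K {Z X Y} f g : rename.

Section CartesianMonoidal.
Variables (C : category) (K : cartesian C).

Definition cmap (X X' Y Y' : C) (f : hom X X') (g : hom Y Y') :
    hom (cprod K X Y) (cprod K X' Y') :=
  cpair K (f \o cfst K X Y) (g \o csnd K X Y).

Definition cartesian_smc : smc_data C :=
  {| tens := cprod K;
     tmap := cmap;
     tunit := cterm K;
     assoc := fun X Y Z =>
       cpair K (cfst K X Y \o cfst K (cprod K X Y) Z)
         (cpair K (csnd K X Y \o cfst K (cprod K X Y) Z) (csnd K (cprod K X Y) Z));
     lunit := fun X => csnd K (cterm K) X;
     runit := fun X => cfst K X (cterm K);
     swap := fun X Y => cpair K (csnd K X Y) (cfst K X Y) |}.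

Lemma cmap_inv (X X' Y Y' : C) (f : hom X X') (f' : hom X' X)
    (g : hom Y Y') (g' : hom Y' Y) :
  f' \o f = idm X -> g' \o g = idm Y -> cmap f' g' \o cmap f g = idm (cprod K X Y).
Proof.
intros Hf Hg.
transitivity (cpair K (cfst K X Y) (csnd K X Y)).
- apply cpair_unique; rewrite comp_assoc; unfold cmap at 1.
  + rewrite cfst_pair, <- comp_assoc; unfold cmap.
    now rewrite cfst_pair, comp_assoc, Hf, comp_id_l.
  + rewrite csnd_pair, <- comp_assoc; unfold cmap.
    now rewrite csnd_pair, comp_assoc, Hg, comp_id_l.
- symmetry; apply cpair_unique; apply comp_id_r.
Qed.

Definition cprod_iso (X X' Y Y' : C) (u : iso X X') (v : iso Y Y') :
    iso (cprod K X Y) (cprod K X' Y') :=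
  {| iso_hom := cmap (iso_hom u) (iso_hom v);
     iso_inv := cmap (iso_inv u) (iso_inv v);
     iso_hom_inv := cmap_inv (iso_hom_inv u) (iso_hom_inv v);
     iso_inv_hom := cmap_inv (iso_inv_hom u) (iso_inv_hom v) |}.

End CartesianMonoidal.

Definition id_iso (C : category) (X : C) : iso X X :=
  Iso (comp_id_l (idm X)) (comp_id_l (idm X)).

Definition directed (T : Type) (le : relation T) (A : T -> Prop) : Prop :=
  (exists x, A x) /\
  forall x y, A x -> A y -> exists z, A z /\ le x z /\ le y z.

Definition is_lub (T : Type) (le : relation T) (A : T -> Prop) (s : T) : Prop :=
  (forall x, A x -> le x s) /\
  forall u, (forall x, A x -> le x u) -> le s u.

Definition image (S T : Type) (f : S -> T) (A : S -> Prop) : T -> Prop :=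
  fun y => exists x, A x /\ f x = y.

Record pdcpo := Pdcpo {
  carrier :> Type;
  le : relation carrier;
  le_order : order carrier le;
  bot : carrier;
  bot_le : forall x, le bot x;
  directed_complete : forall A, directed le A -> exists s, is_lub le A s
}.
Arguments le {p} _ _.
Arguments bot {p}.

Definition continuous (D E : pdcpo) (f : D -> E) : Prop :=
  forall (A : D -> Prop) (s : D),
    directed le A -> is_lub le A s -> is_lub le (image f A) (f s).

Record cont (D E : pdcpo) := Cont {
  cont_fun :> D -> E;
  cont_continuous : continuous cont_fun
}.

(* Morphism equality is Leibniz equality; this is where functional extensionality
   and proof irrelevance enter. *)
Lemma cont_ext (D E : pdcpo) (f g : cont D E) : (forall x, f x = g x) -> f = g.
Proof.
destruct f as [f Hf], g as [g Hg]; simpl; intros H.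
apply functional_extensionality in H; subst g.
f_equal; apply proof_irrelevance.
Qed.

Lemma continuous_monotone (D E : pdcpo) (f : D -> E) :
  continuous f -> forall x y, le x y -> le (f x) (f y).
Proof.
intros Hf x y Hxy.
pose proof (ord_refl _ _ (le_order D)) as R.
destruct (Hf (fun z => z = x \/ z = y) y) as [Hub _].
- split; [now exists x; left|].
  intros a b Ha Hb; exists y.
  split; [now right|].
  destruct Ha, Hb; subst; auto.
- split; [intros z [-> | ->]; auto | intros u Hu; apply Hu; now right].
- apply Hub; exists x; split; [now left | reflexivity].
Qed.

Lemma directed_image (D E : pdcpo) (f : D -> E) (A : D -> Prop) :
  (forall x y, le x y -> le (f x) (f y)) ->
  directed le A -> directed le (image f A).
Proof.
intros Hf [[a Ha] HA]; split.
- exists (f a), a; auto.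
- intros _ _ [x [Hx <-]] [y [Hy <-]].
  destruct (HA x y Hx Hy) as [z [Hz [Hxz Hyz]]].
  exists (f z); split; [exists z; auto | auto].
Qed.

Lemma continuous_id (D : pdcpo) : continuous (fun x : D => x).
Proof.
intros A s _ [Hub Hleast]; split.
- intros _ [x [Hx <-]]; auto.
- intros u Hu; apply Hleast; intros x Hx; apply Hu; exists x; auto.
Qed.

Lemma continuous_comp (D E F : pdcpo) (g : E -> F) (f : D -> E) :
  continuous g -> continuous f -> continuous (fun x => g (f x)).
Proof.
intros Hg Hf A s HA Hs.
assert (HfA := directed_image (continuous_monotone Hf) HA).
destruct (Hg _ _ HfA (Hf _ _ HA Hs)) as [Hub Hleast]; split.
- intros _ [x [Hx <-]]; apply Hub; exists (f x); split; [exists x|]; auto.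
- intros u Hu; apply Hleast; intros _ [_ [[x [Hx <-]] <-]].
  apply Hu; exists x; auto.
Qed.

Definition cont_id (D : pdcpo) : cont D D := Cont (@continuous_id D).

Definition cont_comp (D E F : pdcpo) (g : cont E F) (f : cont D E) : cont D F :=
  Cont (continuous_comp (cont_continuous g) (cont_continuous f)).

Definition DCPO : category.
Proof.
refine {| ob := pdcpo; hom := cont; idm := cont_id; comp := cont_comp |}.
- abstract (now intros; apply cont_ext).
- abstract (now intros; apply cont_ext).
- abstract (now intros; apply cont_ext).
Defined.

Definition prod_le (D E : pdcpo) : relation (D * E) :=
  fun p q => le (fst p) (fst q) /\ le (snd p) (snd q).

Lemma prod_le_order (D E : pdcpo) : order (D * E) (@prod_le D E).
Proof.
destruct (le_order D) as [rD tD aD], (le_order E) as [rE tE aE].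
split.
- intros [x y]; split; auto.
- intros [x y] [x' y'] [x'' y''] [H1 H2] [H3 H4]; split; simpl in *; eauto.
- intros [x y] [x' y'] [H1 H2] [H3 H4]; simpl in *; f_equal; auto.
Qed.

Lemma prod_bot_le (D E : pdcpo) (p : D * E) : prod_le (bot, bot) p.
Proof. split; apply bot_le. Qed.

Lemma prod_directed_complete (D E : pdcpo) (A : D * E -> Prop) :
  directed (@prod_le D E) A -> exists s, is_lub (@prod_le D E) A s.
Proof.
intros [[a Ha] HA].
destruct (@directed_complete D (image fst A)) as [s [s1 s2]].
{ split; [now exists (fst a), a|].
  intros _ _ [p [Hp <-]] [q [Hq <-]].
  destruct (HA p q Hp Hq) as [r [Hr [[] []]]].
  exists (fst r); split; [now exists r | auto]. }
destruct (@directed_complete E (image snd A)) as [t [t1 t2]].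
{ split; [now exists (snd a), a|].
  intros _ _ [p [Hp <-]] [q [Hq <-]].
  destruct (HA p q Hp Hq) as [r [Hr [[] []]]].
  exists (snd r); split; [now exists r | auto]. }
exists (s, t); split.
- intros p Hp; split; simpl; [apply s1 | apply t1]; now exists p.
- intros u Hu; split; simpl; [apply s2 | apply t2];
    intros _ [p [Hp <-]]; now apply Hu.
Qed.

Definition prod_pdcpo (D E : pdcpo) : pdcpo :=
  {| carrier := D * E;
     le := @prod_le D E;
     le_order := prod_le_order D E;
     bot := (bot, bot);
     bot_le := @prod_bot_le D E;
     directed_complete := @prod_directed_complete D E |}.

Definition unit_pdcpo : pdcpo.
Proof.
refine {| carrier := unit; le := fun _ _ => True; bot := tt |}.
- abstract (split; [now intros x | now intros x y z | now intros [] []]).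
- abstract (exact (fun _ => I)).
- abstract (intros A _; now exists tt).
Defined.

Lemma continuous_fst (D E : pdcpo) : continuous (D := prod_pdcpo D E) fst.
Proof.
intros A s _ [Hub Hleast]; split.
- intros _ [p [Hp <-]]; now apply Hub.
- intros u Hu; apply (Hleast (u, snd s)); intros p Hp; split; simpl.
  + apply Hu; now exists p.
  + now apply Hub.
Qed.

Lemma continuous_snd (D E : pdcpo) : continuous (D := prod_pdcpo D E) snd.
Proof.
intros A s _ [Hub Hleast]; split.
- intros _ [p [Hp <-]]; now apply Hub.
- intros u Hu; apply (Hleast (fst s, u)); intros p Hp; split; simpl.
  + now apply Hub.
  + apply Hu; now exists p.
Qed.

Lemma continuous_pair (F D E : pdcpo) (f : F -> D) (g : F -> E) :
  continuous f -> continuous g ->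
  continuous (E := prod_pdcpo D E) (fun x => (f x, g x)).
Proof.
intros Hf Hg A s HA Hs.
destruct (Hf A s HA Hs) as [f1 f2], (Hg A s HA Hs) as [g1 g2]; split.
- intros _ [x [Hx <-]]; split; simpl; [apply f1 | apply g1]; now exists x.
- intros u Hu; split; simpl; [apply f2 | apply g2]; intros _ [x [Hx <-]];
    apply (Hu (f x, g x)); now exists x.
Qed.

Lemma continuous_tt (D : pdcpo) : continuous (E := unit_pdcpo) (fun _ : D => tt).
Proof. intros A s _ _; now split. Qed.

Definition DCPO_cartesian : cartesian DCPO.
Proof.
refine (@Cartesian DCPO prod_pdcpo
  (fun D E => Cont (@continuous_fst D E))
  (fun D E => Cont (@continuous_snd D E))
  (fun F D E f g => Cont (continuous_pair (cont_continuous f) (cont_continuous g)))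
  _ _ _ unit_pdcpo (fun D => Cont (@continuous_tt D)) _).
- abstract (now intros; apply cont_ext).
- abstract (now intros; apply cont_ext).
- abstract (intros F D E f g h <- <-; apply cont_ext; intros x; simpl;
            now destruct (cont_fun h x)).
- abstract (intros D h; apply cont_ext; intros x; now destruct (cont_fun h x)).
Defined.

Record dcpo_category := DcpoCategory {
  dob :> Type;
  dhom : dob -> dob -> pdcpo;
  did : forall X, dhom X X;
  dcomp : forall X Y Z, dhom Y Z -> dhom X Y -> dhom X Z;
  dcomp_id_l : forall X Y (f : dhom X Y), dcomp (did Y) f = f;
  dcomp_id_r : forall X Y (f : dhom X Y), dcomp f (did X) = f;
  dcomp_assoc : forall W X Y Z (h : dhom Y Z) (g : dhom X Y) (f : dhom W X),
    dcomp h (dcomp g f) = dcomp (dcomp h g) f;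
  dcomp_continuous : forall X Y Z,
    continuous (D := prod_pdcpo (dhom Y Z) (dhom X Y))
      (fun p => dcomp (fst p) (snd p));
  dcomp_bot_l : forall X Y Z (f : dhom X Y), dcomp (bot : dhom Y Z) f = bot;
  dcomp_bot_r : forall X Y Z (g : dhom Y Z), dcomp g (bot : dhom X Y) = bot
}.

Definition dcpo_underlying (C : dcpo_category) : category :=
  {| ob := C;
     hom := @dhom C;
     idm := @did C;
     comp := @dcomp C;
     comp_id_l := @dcomp_id_l C;
     comp_id_r := @dcomp_id_r C;
     comp_assoc := @dcomp_assoc C |}.

Record dagger (C : category) := Dagger {
  dag :> forall X Y : C, hom X Y -> hom Y X;
  dag_id : forall X, dag (idm X) = idm X;
  dag_comp : forall X Y Z (g : hom Y Z) (f : hom X Y),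
    dag (g \o f) = dag f \o dag g;
  dag_dag : forall X Y (f : hom X Y), dag (dag f) = f
}.

Record dcpo_dagger_category := DcpoDaggerCategory {
  ddc_dcpo :> dcpo_category;
  ddc_dagger : dagger (dcpo_underlying ddc_dcpo);
  ddc_monotone : forall (X Y : ddc_dcpo) (f g : dhom X Y),
    le f g -> le (p := dhom Y X) (ddc_dagger X Y f) (ddc_dagger X Y g)
}.

(* Objects of DcpoOp(C) are formal expressions, because the involution is defined
   by cases on the form of an object: the pointed dcpo denoted by an expression
   need not determine the expression. *)
Inductive functional_type (T : Type) : Type :=
| FHom (X Y : T)
| FHomOp (X Y : T)
| FOne
| FProd (A B : functional_type T).
Arguments FOne {T}.

Fixpoint interp (C : dcpo_category) (A : functional_type C) : pdcpo :=
  match A with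
  | FHom X Y => dhom X Y
  | FHomOp X Y => dhom Y X
  | FOne => unit_pdcpo
  | FProd A B => prod_pdcpo (interp A) (interp B)
  end.

Definition DcpoOp (C : dcpo_category) : category :=
  full_subcategory (D := DCPO) (@interp C).

Definition DcpoOp_cartesian (C : dcpo_category) : cartesian (DcpoOp C) :=
  @Cartesian (DcpoOp C) (@FProd C)
    (fun A B => cfst DCPO_cartesian (interp A) (interp B))
    (fun A B => csnd DCPO_cartesian (interp A) (interp B))
    (fun Z A B f g => cpair DCPO_cartesian f g)
    (fun Z A B => @cfst_pair _ DCPO_cartesian (interp Z) (interp A) (interp B))
    (fun Z A B => @csnd_pair _ DCPO_cartesian (interp Z) (interp A) (interp B))
    (fun Z A B => @cpair_unique _ DCPO_cartesian (interp Z) (interp A) (interp B))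
    FOne
    (fun Z => cbang DCPO_cartesian (interp Z))
    (fun Z => @cbang_unique _ DCPO_cartesian (interp Z)).

Definition DcpoOp_smc (C : dcpo_category) : smc_data (DcpoOp C) :=
  cartesian_smc (DcpoOp_cartesian C).

Fixpoint bar_ob (T : Type) (A : functional_type T) : functional_type T :=
  match A with
  | FHom X Y => FHomOp X Y
  | FHomOp X Y => FHom X Y
  | FOne => FOne
  | FProd A B => FProd (bar_ob A) (bar_ob B)
  end.

Lemma bar_ob_bar_ob (T : Type) (A : functional_type T) : A = bar_ob (bar_ob A).
Proof. induction A as [| | |A IHA B IHB]; simpl; congruence. Qed.

Section Involution.
Variable C : dcpo_dagger_category.

Lemma dagger_continuous (X Y : C) :
  continuous (D := dhom X Y) (E := dhom Y X) (ddc_dagger C X Y).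
Proof.
intros A s _ [Hub Hleast]; split.
- intros _ [f [Hf <-]]; apply ddc_monotone; auto.
- intros u Hu.
  rewrite <- (dag_dag (ddc_dagger C) (X := Y) (Y := X) u).
  apply ddc_monotone, Hleast; intros f Hf.
  rewrite <- (dag_dag (ddc_dagger C) (X := X) (Y := Y) f).
  apply ddc_monotone, Hu; exists f; auto.
Qed.

Definition dagger_cont (X Y : C) : cont (dhom X Y) (dhom Y X) :=
  Cont (@dagger_continuous X Y).

Lemma dagger_cont_dagger_cont (X Y : C) :
  cont_comp (dagger_cont Y X) (dagger_cont X Y) = cont_id (dhom X Y).
Proof. apply cont_ext; intros f; apply (dag_dag (ddc_dagger C)). Qed.

Fixpoint xi (A : DcpoOp C) : iso A (bar_ob A : DcpoOp C) :=
  match A return iso (A : DcpoOp C) (bar_ob A : DcpoOp C) with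
  | FHom X Y =>
      @Iso (DcpoOp C) (FHom X Y) (FHomOp X Y) (dagger_cont X Y) (dagger_cont Y X)
        (dagger_cont_dagger_cont X Y) (dagger_cont_dagger_cont Y X)
  | FHomOp X Y =>
      @Iso (DcpoOp C) (FHomOp X Y) (FHom X Y) (dagger_cont Y X) (dagger_cont X Y)
        (dagger_cont_dagger_cont Y X) (dagger_cont_dagger_cont X Y)
  | FOne => id_iso (FOne : DcpoOp C)
  | FProd A B => cprod_iso (DcpoOp_cartesian C) (xi A) (xi B)
  end.

Definition bar_functor : functor_data (DcpoOp C) (DcpoOp C) :=
  {| fob := (@bar_ob C : DcpoOp C -> DcpoOp C);
     fmap := fun A B phi => iso_hom (xi B) \o phi \o iso_inv (xi A) |}.

(* The involution commutes with products and preserves the unit on the nose,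
   hence identities as comparison maps. *)
Definition bar : monoidal_functor_data (DcpoOp_smc C) (DcpoOp_smc C) :=
  @MonoidalFunctorData _ _ (DcpoOp_smc C) (DcpoOp_smc C) bar_functor
    (fun A B => idm (FProd (bar_ob A) (bar_ob B) : DcpoOp C))
    (idm (FOne : DcpoOp C)).

Definition iota (A : DcpoOp C) : hom A (bar (bar A)) :=
  eq_hom (C := DcpoOp C) (bar_ob_bar_ob A).

End Involution.

(* Main.v *)
Require Import Defs.
From Stdlib Require Import ProofIrrelevance.

Set Implicit Arguments.
Unset Strict Implicit.
Unset Printing Implicit Defensive.

(** The involution sends [phi : A -> B] to the conjugate
    [xi_B o phi o xi_A^-1], so it is the unique functor structure on the object
    map [bar_ob] for which [xi] is a natural isomorphism from the identity.
    Hence everything about it is inherited from the identity functor along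
    [xi]: functoriality is immediate, and since [xi] of a product (of the unit)
    is the product of the [xi]'s (the identity), the identity comparison maps
    are exactly those making [xi] monoidal; this forces the coherence laws
    ([conjugation_monoidal]).  The argument takes place in an arbitrary symmetric
    monoidal category with isomorphisms [x X : X -> b X].

    The same holds for the unit of the involution as soon as it is the composite
    [x (b X) o x X] ([conjugation_involutive], [conjugation_unit_monoidal]):
    naturality composes two naturality squares of [x], and the coherence
    [i (b X) = bar (i X)] becomes the cancellation of [x X] with its inverse.
    What remains to be proved about [xi] itself is [iota_xi]: the canonical
    identification of [A] with [bar_ob (bar_ob A)] is that composite, because the
    dagger is an involution on homsets and both sides are compatible with
    products.  Together with the fact that finite products give a symmetric
    monoidal structure ([cartesian_smc_is_smc]), this yields the theorem. *)

(** * Finite products are symmetric monoidal *)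

Section Cartesian.
Variables (C : category) (K : cartesian C).

Lemma cpair_comp (W Z X Y : C) (f : hom Z X) (g : hom Z Y) (h : hom W Z) :
  cpair K f g \o h = cpair K (f \o h) (g \o h).
Proof.
apply cpair_unique; rewrite comp_assoc.
- now rewrite cfst_pair.
- now rewrite csnd_pair.
Qed.

Lemma cprod_ext (Z X Y : C) (h k : hom Z (cprod K X Y)) :
  cfst K X Y \o h = cfst K X Y \o k -> csnd K X Y \o h = csnd K X Y \o k -> h = k.
Proof.
intros H1 H2.
rewrite (cpair_unique (c := K) (h := h) H1 H2).
symmetry; now apply cpair_unique.
Qed.

Lemma cterm_ext (Z : C) (h k : hom Z (cterm K)) : h = k.
Proof. now rewrite (cbang_unique (c := K) h), (cbang_unique (c := K) k). Qed.

(* Composites are associated to the right and pairings pulled outwards, so that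
   every projection of a pairing becomes a redex; two morphisms built from
   projections are then compared componentwise. *)
Local Ltac cart_simpl :=
  unfold cmap;
  repeat (rewrite <- comp_assoc || rewrite cpair_comp || rewrite cfst_pair
          || rewrite csnd_pair || rewrite comp_id_l || rewrite comp_id_r).
Local Ltac cart :=
  simpl; cart_simpl;
  repeat first [reflexivity | apply cterm_ext | apply cprod_ext; cart_simpl].

Lemma cmap_id (X Y : C) : cmap K (idm X) (idm Y) = idm (cprod K X Y).
Proof. cart. Qed.

Lemma cartesian_smc_is_smc : is_smc (cartesian_smc K).
Proof.
split; try (intros; cart; fail).
- intros X Y Z.
  exists (cpair K (cpair K (cfst K X (cprod K Y Z))
                           (cfst K Y Z \o csnd K X (cprod K Y Z)))
                  (csnd K Y Z \o csnd K X (cprod K Y Z))).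
  split; cart.
- intros X; exists (cpair K (cbang K X) (idm X)); split; cart.
- intros X; exists (cpair K (idm X) (cbang K X)); split; cart.
Qed.

End Cartesian.

(** * Functors conjugate to the identity *)

Section Isomorphisms.
Variable C : category.

Lemma iso_is_iso (X Y : C) (u : iso X Y) : is_iso (iso_hom u).
Proof.
exists (iso_inv u); split; [apply iso_hom_inv | apply iso_inv_hom].
Qed.

Lemma is_iso_comp (X Y Z : C) (g : hom Y Z) (f : hom X Y) :
  is_iso g -> is_iso f -> is_iso (g \o f).
Proof.
intros [g' [Hg1 Hg2]] [f' [Hf1 Hf2]]; exists (f' \o g'); split.
- now rewrite comp_assoc, <- (comp_assoc f' g' g), Hg1, comp_id_r.
- now rewrite comp_assoc, <- (comp_assoc g f f'), Hf2, comp_id_r.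
Qed.

Lemma is_iso_epi (X Y Z : C) (e : hom X Y) (f g : hom Y Z) :
  is_iso e -> f \o e = g \o e -> f = g.
Proof.
intros [e' [_ He]] H.
now rewrite <- (comp_id_r f), <- (comp_id_r g), <- He, !comp_assoc, H.
Qed.

Lemma is_iso_cancel_r (X Y Z : C) (g : hom Y Z) (f : hom X Y) :
  is_iso f -> is_iso (g \o f) -> is_iso g.
Proof.
intros Hf [k [Hk1 Hk2]]; exists (f \o k); split.
- apply (is_iso_epi Hf).
  now rewrite <- !comp_assoc, Hk1, comp_id_l, comp_id_r.
- now rewrite comp_assoc, Hk2.
Qed.

End Isomorphisms.

Section Conjugation.
Variables (C : category) (b : C -> C) (x : forall X : C, iso X (b X)).

Definition conjugation : functor_data C C :=
  {| fob := b; fmap := fun X Y f => iso_hom (x Y) \o f \o iso_inv (x X) |}.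

(** As [x X] is invertible, this determines [fmap conjugation f]; later proofs
    rely on it and seldom unfold the definition. *)
Lemma conjugation_natural (X Y : C) (f : hom X Y) :
  fmap conjugation f \o iso_hom (x X) = iso_hom (x Y) \o f.
Proof.
simpl; now rewrite <- comp_assoc, iso_hom_inv, comp_id_r.
Qed.

Lemma conjugation_functor : is_functor conjugation.
Proof.
split.
- intros X; simpl; now rewrite comp_id_r, iso_inv_hom.
- intros X Y Z g f; apply (is_iso_epi (iso_is_iso (x X))).
  rewrite <- (comp_assoc (fmap conjugation g)), !conjugation_natural.
  now rewrite (comp_assoc (fmap conjugation g)), conjugation_natural, comp_assoc.
Qed.

Section Involution.
Variable i : forall X, hom X (b (b X)).
Hypothesis i_x : forall X, i X = iso_hom (x (b X)) \o iso_hom (x X).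

Lemma conjugation_unit_natural_iso :
  is_natural_iso (F := id_functor C) (G := comp_functor conjugation conjugation) i.
Proof.
split.
- intros X Y f; rewrite !i_x; cbn [fob fmap id_functor comp_functor conjugation].
  rewrite <- !comp_assoc, (comp_assoc (iso_inv (x (b X)))), iso_hom_inv.
  now rewrite comp_id_l, iso_hom_inv, comp_id_r.
- intros X; rewrite i_x; apply is_iso_comp; apply iso_is_iso.
Qed.

Lemma conjugation_involutive : is_involutive (F := conjugation) i.
Proof.
split.
- exact conjugation_functor.
- exact conjugation_unit_natural_iso.
- intros X; apply (is_iso_epi (iso_is_iso (x X))).
  now rewrite conjugation_natural, !i_x, comp_assoc.
Qed.

End Involution.

Section Monoidal.
Variables (M : smc_data C) (M_smc : is_smc M).
Variables (mu : forall X Y, hom (tens M (b X) (b Y)) (b (tens M X Y)))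
          (eps : hom (tunit M) (b (tunit M))).
Hypothesis x_tens :
  forall X Y, iso_hom (x (tens M X Y)) = mu X Y \o tmap M (iso_hom (x X)) (iso_hom (x Y)).
Hypothesis x_unit : iso_hom (x (tunit M)) = eps.

Definition monoidal_conjugation : monoidal_functor_data M M :=
  @MonoidalFunctorData C C M M conjugation mu eps.

Lemma tmap_is_iso (X X' Y Y' : C) (f : hom X X') (g : hom Y Y') :
  is_iso f -> is_iso g -> is_iso (tmap M f g).
Proof.
intros [f' [Hf1 Hf2]] [g' [Hg1 Hg2]]; exists (tmap M f' g'); split;
  rewrite <- (tmap_comp M_smc).
- now rewrite Hf1, Hg1, (tmap_id M_smc).
- now rewrite Hf2, Hg2, (tmap_id M_smc).
Qed.

(** Each coherence law is an equation between morphisms out of a tensor of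
    objects [b X] and of the unit.  It may be checked after precomposition with
    the corresponding tensor of isomorphisms [x X] and identities.  There [x_tens],
    [x_unit] and naturality move the isomorphisms to the left of the structure
    maps, and both sides become the same structure map followed by one [x]. *)
Lemma conjugation_monoidal : is_monoidal_functor monoidal_conjugation.
Proof.
assert (Hx : forall X, is_iso (iso_hom (x X))) by (intros; apply iso_is_iso).
split; cbn [mf_functor mf_mu mf_eps monoidal_conjugation].
- exact conjugation_functor.
- intros X Y; apply (is_iso_cancel_r (tmap_is_iso (Hx X) (Hx Y))).
  rewrite <- x_tens; apply Hx.
- rewrite <- x_unit; apply Hx.
- intros X X' Y Y' f g; apply (is_iso_epi (tmap_is_iso (Hx X) (Hx Y))).
  rewrite <- !comp_assoc, <- x_tens, conjugation_natural, <- (tmap_comp M_smc).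
  now rewrite !conjugation_natural, (tmap_comp M_smc), comp_assoc, <- x_tens.
- intros X Y Z.
  apply (is_iso_epi (tmap_is_iso (tmap_is_iso (Hx X) (Hx Y)) (Hx Z))).
  rewrite <- !comp_assoc, (assoc_natural M_smc), <- (tmap_comp M_smc).
  rewrite <- x_tens, comp_id_l, <- x_tens, conjugation_natural.
  rewrite (comp_assoc (tmap M (idm (b X)) (mu Y Z))), <- (tmap_comp M_smc).
  now rewrite <- x_tens, comp_id_l, comp_assoc, <- x_tens.
- intros X.
  apply (is_iso_epi (tmap_is_iso (iso_is_iso (id_iso (tunit M))) (Hx X))); simpl iso_hom.
  rewrite <- !comp_assoc, <- (tmap_comp M_smc), comp_id_l, comp_id_r, <- x_unit.
  now rewrite <- x_tens, conjugation_natural, (lunit_natural M_smc).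
- intros X.
  apply (is_iso_epi (tmap_is_iso (Hx X) (iso_is_iso (id_iso (tunit M))))); simpl iso_hom.
  rewrite <- !comp_assoc, <- (tmap_comp M_smc), comp_id_l, comp_id_r, <- x_unit.
  now rewrite <- x_tens, conjugation_natural, (runit_natural M_smc).
Qed.

Lemma conjugation_unit_monoidal (i : forall X, hom X (b (b X))) :
  (forall X, i X = iso_hom (x (b X)) \o iso_hom (x X)) ->
  is_monoidal_natural_iso (F := id_monoidal_functor M)
    (G := comp_monoidal_functor monoidal_conjugation monoidal_conjugation) i.
Proof.
intros i_x; split.
- exact (conjugation_unit_natural_iso i_x).
- intros X Y.
  cbn [mf_functor mf_mu comp_monoidal_functor id_monoidal_functor monoidal_conjugation].
  rewrite comp_id_r, !i_x, (tmap_comp M_smc).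
  rewrite <- (comp_assoc (fmap conjugation (mu X Y))).
  rewrite (comp_assoc (mu (b X) (b Y))), <- x_tens.
  now rewrite comp_assoc, conjugation_natural, <- comp_assoc, <- x_tens.
- cbn [mf_functor mf_eps comp_monoidal_functor id_monoidal_functor monoidal_conjugation].
  now rewrite comp_id_r, i_x, <- x_unit, conjugation_natural.
Qed.

End Monoidal.
End Conjugation.

(** * The unit of the involution *)

(** Stated for an arbitrary proof [e] because the equality of objects used by
    [iota] is not built from the equalities of the two factors; only proof
    irrelevance relates them. *)
Lemma eq_hom_prod (C : dcpo_category) (A A' B B' : DcpoOp C)
    (u : A = A') (v : B = B')
    (e : FProd A B = FProd A' B' :> DcpoOp C) :
  eq_hom (C := DcpoOp C) e
  = cmap (DcpoOp_cartesian C) (eq_hom (C := DcpoOp C) u) (eq_hom (C := DcpoOp C) v).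
Proof.
destruct u, v; rewrite (proof_irrelevance _ e eq_refl).
symmetry; apply (cmap_id (DcpoOp_cartesian C)).
Qed.

Lemma eq_hom_refl (C : category) (X : C) (e : X = X) : eq_hom e = idm X.
Proof. now rewrite (proof_irrelevance _ e eq_refl). Qed.

(** Both sides are compatible with products, so this reduces to a homset, where
    it says that the dagger is its own inverse. *)
Lemma iota_xi (C : dcpo_dagger_category) (A : DcpoOp C) :
  iota A = iso_hom (xi (bar_ob A : DcpoOp C)) \o iso_hom (xi A).
Proof.
unfold iota; induction A as [X Y|X Y| |A IHA B IHB].
- rewrite eq_hom_refl; symmetry; exact (dagger_cont_dagger_cont X Y).
- rewrite eq_hom_refl; symmetry; exact (dagger_cont_dagger_cont Y X).
- rewrite eq_hom_refl; symmetry.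
  exact (comp_id_l (idm (FOne : DcpoOp C))).
- etransitivity; [exact (eq_hom_prod (bar_ob_bar_ob A) (bar_ob_bar_ob B) _)|].
  rewrite IHA, IHB.
  exact (tmap_comp (cartesian_smc_is_smc (DcpoOp_cartesian C)) _ _ _ _).
Qed.

Theorem theorem1 (C : dcpo_dagger_category) :
  @is_involutive_smc (DcpoOp C) (DcpoOp_smc C) (bar C) (@iota C).
Proof.
assert (M_smc : is_smc (DcpoOp_smc C)) by apply cartesian_smc_is_smc.
assert (xi_prod : forall A B : DcpoOp C,
  iso_hom (xi (FProd A B : DcpoOp C))
  = idm (FProd (bar_ob A) (bar_ob B) : DcpoOp C)
    \o tmap (DcpoOp_smc C) (iso_hom (xi A)) (iso_hom (xi B)))
  by (intros A B; symmetry; apply (comp_id_l (c := DcpoOp C))).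
split.
- exact M_smc.
- exact (conjugation_involutive (@iota_xi C)).
- exact (conjugation_monoidal M_smc xi_prod eq_refl).
- exact (conjugation_unit_monoidal M_smc xi_prod eq_refl (@iota_xi C)).
Qed.
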